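(* Let $\bar X=\mathrm{MC}(\alpha_X,P_X)$, $\bar Y=\mathrm{MC}(\alpha_Y,P_Y)$ and $\bar Z=\mathrm{MC}(\alpha_Z,P_Z)$ be homogeneous Markov chains on countable state spaces $A$, $B$, $C$, and let $f:A\to C$, $g:B\to C$ be maps with $(f(\bar X_t))_{t\ge0}\overset{d}{=}\bar Z\overset{d}{=}(g(\bar Y_t))_{t\ge0}$. Suppose that $f$ is an exact lumping of $\mathrm{MC}(\alpha_X,P_X)$ to $\mathrm{MC}(\alpha_Z,P_Z)$, that $B$ contains no states that are almost surely never visited by $\bar Y$, and that $A$ contains no states that are almost surely never visited by $\bar X$. Let $\mathrm{MC}(\alpha,P)$ be the Markov chain on $\Delta'$ defined in the context, which is a coupling of $\bar X$ and $\bar Y$. Then the projection $\mathrm{proj}^2:\Delta'\to B$, $(a,b)\mapsto b$, is an exact lumping of $\mathrm{MC}(\alpha,P)$ to $\mathrm{MC}(\alpha_Y,P_Y)$.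
   Context: $\mathrm{MC}(\alpha,P)$ denotes the discrete-time homogeneous Markov chain with time indexed by $\{0,1,2,\dots\}$, initial distribution $\alpha$ and transition matrix $P$. $\overset{d}{=}$ denotes equality in law. Construction of $(\alpha,P)$. Let $\Delta=\{(a,b)\in A\times B:f(a)=g(b)\}$ and let $R$ be the matrix indexed by $\Delta$ with $R((a,b),(a',b'))=P_X(a,a')P_Y(b,b')/P_Z(f(a),f(a'))$ if $P_Z(f(a),f(a'))>0$ and $0$ otherwise. Let $\varphi=\lim_{m\to\infty}R^m\mathbf 1_\Delta$ coordinatewise ($\mathbf 1_\Delta$ the column vector of $1$s); this limit exists and is finite. Let $\Delta'=\{(a,b)\in\Delta:\varphi(a,b)>0\}$. For $(a,b)\in\Delta'$ with $c=f(a)=g(b)$, let $\alpha(a,b)=\frac{\alpha_X(a)\alpha_Y(b)}{\alpha_Z(c)}\varphi(a,b)$ if $\alpha_Z(c)>0$ and $\alpha(a,b)=0$ if $\alpha_Z(c)=0$. For $(a,b),(a',b')\in\Delta'$, let $P((a,b),(a',b'))=\frac{1}{\varphi(a,b)}R((a,b),(a',b'))\varphi(a',b')$. Then $\alpha$ is a probability vector and $P$ a stochastic matrix on $\Delta'$. Exact lumping. Let $h:U\twoheadrightarrow V$ be a surjection between countable sets, $P$ a stochastic matrix on $U$, $\alpha$ a probability distribution on $U$, and $Q$ a stochastic matrix on $V$. We say that $h$ is an exact lumping of $\mathrm{MC}(\alpha,P)$ to $\mathrm{MC}(h_*(\alpha),Q)$ ($h_*(\alpha)$ being the pushforward) if there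 is a family $(\nu_z)_{z\in V}$, with each $\nu_z$ a probability distribution on $h^{-1}(z)$, such that for every $z,z'\in V$ and every $x'\in h^{-1}(z')$, $$\sum_{x\in h^{-1}(z)}\nu_z(x)P(x,x')=Q(z,z')\nu_{z'}(x'),$$ and $\alpha$ is a (countable) convex combination of the measures $(\nu_z)_{z\in V}$. *)

(* Defs.v *)
From HB Require Import structures.
From mathcomp Require Import all_boot all_order all_algebra.
From mathcomp Require Import all_classical all_reals all_analysis.

Set Implicit Arguments.
Unset Strict Implicit.
Unset Printing Implicit Defensive.

Import Order.TTheory GRing.Theory Num.Theory.

Local Open Scope classical_set_scope.
Local Open Scope ring_scope.

Section Stochastic.
Context {R : realType}.

Definition is_distribution {U : countType} (a : U -> R) : Prop :=
  (forall x, 0 <= a x) /\ (\esum_(x in [set: U]) (a x)%:E = 1)%E.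

Definition is_stochastic {U : countType} (P : U -> U -> R) : Prop :=
  forall x, is_distribution (P x).

Definition is_pushforward {U V : countType} (h : U -> V)
    (a : U -> R) (b : V -> R) : Prop :=
  forall z, (\esum_(x in h @^-1` [set z]) (a x)%:E = (b z)%:E)%E.

(* A probability distribution on a fibre of [h] is represented by its extension
   by zero to the whole of [U]. *)
Definition exact_lumping {U V : countType} (h : U -> V)
    (a : U -> R) (P : U -> U -> R) (b : V -> R) (Q : V -> V -> R) : Prop :=
  [/\ forall z, exists x, h x = z,
      is_distribution a /\ is_stochastic P,
      is_pushforward h a b /\ is_stochastic Q
    & exists nu : V -> U -> R,
      [/\ forall z, is_distribution (nu z) /\ (forall x, h x <> z -> nu z x = 0),
          forall z z' x', h x' = z' ->
            (\esum_(x in h @^-1` [set z]) (nu z x * P x x')%:E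
               = (Q z z' * nu z' x')%:E)%E
        & exists2 w : V -> R, is_distribution w &
            forall x, ((a x)%:E = \esum_(z in [set: V]) (w z * nu z x)%:E)%E]].

(* [X] is a version of MC(a, P) defined on the probability space (O, Pr); the
   state space carries the discrete sigma-algebra.  The Markov property is the
   usual one, with the conditioning event multiplied out. *)
Definition markov_chain {U : countType} {d : measure_display}
    {O : measurableType d} (Pr : probability O R) (X : nat -> O -> U)
    (a : U -> R) (P : U -> U -> R) : Prop :=
  [/\ is_distribution a /\ is_stochastic P,
      forall t (E : set U), measurable (X t @^-1` E),
      forall x, Pr (X 0%N @^-1` [set x]) = (a x)%:E
    & forall t (x : nat -> U),
        (Pr [set w | forall s, (s <= t.+1)%N -> X s w = x s] =
         Pr [set w | forall s, (s <= t)%N -> X s w = x s]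
           * (P (x t) (x t.+1))%:E)%E].

Definition path_measurable {U : countType} : set (set (nat -> U)) :=
  <<s [set E | exists t (F : set U), E = [set x | F (x t)]] >>.

Definition equal_in_law {U : countType}
    {d1 : measure_display} {O1 : measurableType d1}
    (Pr1 : probability O1 R) (X1 : nat -> O1 -> U)
    {d2 : measure_display} {O2 : measurableType d2}
    (Pr2 : probability O2 R) (X2 : nat -> O2 -> U) : Prop :=
  forall E : set (nat -> U), path_measurable E ->
    Pr1 [set w | E (fun t => X1 t w)] = Pr2 [set w | E (fun t => X2 t w)].

Definition never_visited {U : countType} {d : measure_display}
    {O : measurableType d} (Pr : probability O R) (X : nat -> O -> U)
    (x : U) : Prop :=
  \forall w \ae Pr, forall t, X t w <> x.

Fixpoint matrix_power {U : countType} (M : U -> U -> R) (m : nat) (x y : U)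
    : \bar R :=
  if m is m'.+1 then
    (\esum_(z in [set: U]) ((M x z)%:E * matrix_power M m' z y))%E
  else ((x == y)%:R)%:E.

End Stochastic.

Section Coupling.
Context {R : realType} {A B C : countType}.
Variables (f : A -> C) (g : B -> C).

Definition Delta : Type := {p : A * B | f p.1 == g p.2}.

Definition fstD (p : Delta) : A := (val p).1.
Definition sndD (p : Delta) : B := (val p).2.

Variables (PX : A -> A -> R) (PY : B -> B -> R) (PZ : C -> C -> R).

Definition Rmat (p q : Delta) : R :=
  let pZ := PZ (f (fstD p)) (f (fstD q)) in
  if 0 < pZ then PX (fstD p) (fstD q) * PY (sndD p) (sndD q) / pZ else 0.

(* [limn] and [fine] are total: [phi] carries its meaning only when the limit
   exists and is finite, which is the case when every state of A and of B is
   visited with positive probability. *)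
Definition phi (p : Delta) : \bar R :=
  limn (fun m => \esum_(q in [set: Delta]) matrix_power Rmat m p q).

Definition Delta' : Type := {p : Delta | (0 < phi p)%E}.

Definition proj_snd (p : Delta') : B := sndD (val p).

Variables (aX : A -> R) (aY : B -> R) (aZ : C -> R).

Definition coupling_alpha (p : Delta') : R :=
  let a := fstD (val p) in
  let b := sndD (val p) in
  if 0 < aZ (f a) then aX a * aY b / aZ (f a) * fine (phi (val p)) else 0.

Definition coupling_P (p q : Delta') : R :=
  (fine (phi (val p)))^-1 * Rmat (val p) (val q) * fine (phi (val q)).

End Coupling.

(* Main.v *)
Require Import Defs.
From mathcomp Require Import all_boot all_order all_algebra.
From mathcomp Require Import all_classical all_reals all_analysis.
From mathcomp Require Import ring.

(** Write [c = f a = g b], and let [F_a], [G_b], [H_c] be the laws of the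
    futures of [f(X)] started at [a], of [g(Y)] started at [b] and of [Z]
    started at [c].  Expanding the matrix power over the paths of the common
    image gives
<<
      (R^m 1)(a, b) = sum over l of length m of F_a(l) G_b(l) / H_c(l),
>>
    the expectation under [H_c] of the product of the densities of [F_a] and
    [G_b] along the first [m] steps ([matrix_power_overlap]).  These densities
    are martingales in [m].

    They are bounded.  If [nu] is the family of kernels of the exact lumping
    [f], then [H_c] is the mixture of the [F_a] with weights [nu c a]
    ([path_law_mixture]), and [nu (f a) a > 0] because [X] visits [a]
    ([visited_nu_gt0]); so [F_a <= H_c / nu (f a) a].  The bound for [G_b] comes
    from a history of [Y] of positive probability that ends in [b], whose image
    is a history of [Z] ([observed_dominated]).  Bounded martingales have
    nondecreasing, bounded second moments, so the expectation of a product
    converges, by polarisation ([overlap_cvg]): [phi] is a finite limit.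

    Mixing over [a] turns [F_a] into [H_c] and the sum above into the total mass
    of [G_b].  Hence [sum_a nu (g b) a * (R^m 1)(a, b) = 1] for all [m], and in
    the limit [sum_a nu (g b) a * phi (a, b) = 1] ([psi_mean]).  Fatou's lemma
    gives [R phi <= phi]; the defining identity of an exact lumping, applied to
    [f], shows that both sides have [nu]-mean one over each fibre of the second
    projection, and since [nu] is positive, [R phi = phi] ([psi_harmonic]).

    Therefore [P] is stochastic, and the measures
    [nu_b (a, b) = nu (g b) a * phi (a, b)] are probability distributions on the
    fibres of the second projection.  The factors [1 / phi] and [phi] in [P]
    cancel, so the identity for [nu] and [P_X] becomes the required one for
    [nu_b] and [P] ([coupling_kernel_intertwines]).  Finally
    [alpha_X a = alpha_Z (f a) * nu (f a) a], so [alpha] is the mixture of the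
    [nu_b] with weights [alpha_Y b]. *)

Set Implicit Arguments.
Unset Strict Implicit.
Unset Printing Implicit Defensive.

Import Order.TTheory GRing.Theory Num.Theory.
Import numFieldNormedType.Exports.

Local Open Scope classical_set_scope.
Local Open Scope ring_scope.
Local Open Scope ereal_scope.

(** * Sums of nonnegative terms *)

Section EsumComplements.
Context {R : realType}.

Lemma esumZ (T : choiceType) (I : set T) (c : R) (a : T -> \bar R) :
  (0 <= c)%R -> (forall i, 0 <= a i) ->
  \esum_(i in I) (c%:E * a i) = c%:E * \esum_(i in I) a i.
Proof.
have le d (b : T -> \bar R) : (0 <= d)%R -> (forall i, 0 <= b i) ->
    \esum_(i in I) (d%:E * b i) <= d%:E * \esum_(i in I) b i.
  move=> d0 b0; apply: ge_ereal_sup => _ [X [finX XI]] <-.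
  rewrite -ge0_mule_fsumr//.
  by apply: lee_wpmul2l; rewrite ?lee_fin//; apply: ereal_sup_ubound; exists X.
move=> c0 a0; apply/eqP; rewrite eq_le le//=.
have [->|cN0] := eqVneq c 0%R.
  by rewrite mul0e esum_ge0// => i _; rewrite mul0e.
have cp : (0 < c)%R by rewrite lt_neqAle eq_sym cN0.
rewrite -lee_pdivlMl//; apply: le_trans (le _ _ _ _); last 2 first.
- by rewrite invr_ge0.
- by move=> i; apply: mule_ge0; rewrite ?lee_fin.
by apply: le_esum => i _; rewrite muleA -EFinM mulVf// mul1e.
Qed.

Lemma esum_ge_term (T : choiceType) (I : set T) (a : T -> \bar R) i :
  I i -> 0 <= a i -> a i <= \esum_(j in I) a j.
Proof.
move=> Ii ai; apply: esum_ge; exists [set i]; last by rewrite fsbig_set1.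
by split; [exact: finite_set1|move=> _ ->].
Qed.

Lemma esum_exchange (T T' : choiceType) (I : set T) (J : set T')
    (a : T -> T' -> \bar R) :
  (forall i j, 0 <= a i j) ->
  \esum_(i in I) \esum_(j in J) a i j = \esum_(j in J) \esum_(i in I) a i j.
Proof.
move=> a0; rewrite !esum_esum//.
rewrite (reindex_esum (J `*`` (fun=> I)) _ (fun x => (x.2, x.1)))//; split.
- by move=> [i j] [/= Jj Ii].
- by move=> [i1 i2] [j1 j2] /= _ _ [-> ->].
- by move=> [i j] [Ii Jj] /=; exists (j, i).
Qed.

Lemma esum_fibers (T T' : choiceType) (h : T -> T') (J : set T')
    (a : T -> \bar R) : (forall i, 0 <= a i) ->
  \esum_(j in J) \esum_(i in h @^-1` [set j]) a i = \esum_(i in h @^-1` J) a i.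
Proof.
move=> a0; rewrite esum_esum//.
rewrite (reindex_esum (h @^-1` J) _ (fun i => (h i, i)))//; split => /=.
- by move=> i.
- by move=> i1 i2 _ _ [].
- by move=> [j i] [/= Jj ij]; exists i; rewrite ?ij.
Qed.

Lemma esum_fibersT (T T' : choiceType) (h : T -> T') (a : T -> \bar R) :
  (forall i, 0 <= a i) ->
  \esum_(j in [set: T']) \esum_(i in h @^-1` [set j]) a i =
  \esum_(i in [set: T]) a i.
Proof. by move=> a0; rewrite esum_fibers. Qed.

Lemma esum_support (T : choiceType) (I J : set T) (a : T -> \bar R) :
  I `<=` J -> (forall i, J i -> ~ I i -> a i = 0) ->
  \esum_(i in I) a i = \esum_(i in J) a i.
Proof.
move=> IJ a0; rewrite -[I in LHS](setIidr IJ) esum_mkcondr.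
apply: eq_esum => i Ji; case: ifPn => // /negP; rewrite inE => Ii.
by rewrite a0.
Qed.

(** Fatou's lemma for sums: every finite partial sum passes to the limit. *)
Lemma esum_fatou (T : choiceType) (I : set T) (u : nat -> T -> R) (v : T -> R)
    (s : nat -> \bar R) (l : \bar R) :
  (forall n i, I i -> (0 <= u n i)%R) ->
  (forall i, I i -> (fun n => u n i) @ \oo --> v i) ->
  (forall n, \esum_(i in I) (u n i)%:E <= s n) -> s @ \oo --> l ->
  \esum_(i in I) (v i)%:E <= l.
Proof.
move=> u0 uv us sl; apply: ge_ereal_sup => _ [X [finX XI]] <-.
rewrite fsbig_finite//=; set r := finmap.enum_fset _.
have rI i : i \in r -> I i by rewrite in_fset_set// inE => /XI.
have cvX : (fun n => \sum_(i <- r) (u n i)%:E) @ \oo -->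
    \sum_(i <- r) (v i)%:E.
  rewrite big_seq; under eq_fun do rewrite big_seq.
  apply: cvg_nnesum => i ir.
    by apply: nearW => n; rewrite lee_fin u0//; exact: rI.
  by apply: cvg_EFin; [by apply: nearW|exact: (uv i (rI i ir))].
have cs : cvgn s by apply/cvg_ex; exists l.
have cX : cvgn (fun n => \sum_(i <- r) (u n i)%:E).
  by apply/cvg_ex; eexists; exact: cvX.
rewrite -(cvg_lim _ cvX)// -(cvg_lim _ sl)//.
apply: lee_lim => //; apply: nearW => n; apply: le_trans (us n).
by apply: esum_ge; exists X; rewrite // fsbig_finite.
Qed.

Lemma esum_eq_terms (T : choiceType) (I : set T) (a b : T -> \bar R) :
  (forall i, I i -> 0 <= a i <= b i) -> \esum_(i in I) b i < +oo ->
  \esum_(i in I) b i <= \esum_(i in I) a i -> forall i, I i -> a i = b i.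
Proof.
move=> ab boo ba i Ii.
have a0 j : I j -> 0 <= a j by case/ab/andP.
have b0 j : I j -> 0 <= b j.
  by move=> Ij; case/andP: (ab _ Ij) => /le_trans; apply.
apply/eqP; rewrite eq_le; case/andP: (ab _ Ii) => _ -> /=.
move: ba boo; rewrite (esumID [set i])// [in leRHS](esumID [set i])//.
have -> : I `&` [set i] = [set i] by apply/setIidr => _ ->.
rewrite !esum_set1 ?a0 ?b0//.
set sb := \esum_(_ in _) b _; set sa := \esum_(_ in _) a _ => ba boo.
have sab : sa <= sb.
  by apply: le_esum => j [Ij _]; case/andP: (ab _ Ij).
have sa0 : 0 <= sa by apply: esum_ge0 => j [Ij _]; exact: a0.
have safin : sa \is a fin_num.
  rewrite ge0_fin_numE//; apply: le_lt_trans sab _.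
  by apply: le_lt_trans boo; rewrite leeDr// b0.
rewrite -(leeD2rE _ _ safin); apply: le_trans ba.
by rewrite leeD2l.
Qed.

End EsumComplements.

(** * Sums over paths of a given length *)

Section PathSums.
Context {R : realType} {C : countType}.
Implicit Types (F G : seq C -> \bar R) (u v H : seq C -> R).

Fixpoint pathsum m F : \bar R :=
  if m is m'.+1 then \esum_(c in [set: C]) pathsum m' (fun l => F (c :: l))
  else F [::].

Lemma pathsum_ge0 m F : (forall l, 0 <= F l) -> 0 <= pathsum m F.
Proof.
by elim: m F => [|m IH] F F0 //=; apply: esum_ge0 => c _; exact: IH.
Qed.

Lemma eq_pathsum m F G : F =1 G -> pathsum m F = pathsum m G.
Proof. by move=> /funext ->. Qed.

Lemma le_pathsum m F G : (forall l, F l <= G l) -> pathsum m F <= pathsum m G.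
Proof.
by elim: m F G => [|m IH] F G FG //=; apply: le_esum => c _; exact: IH.
Qed.

(** The recursion of [pathsum] adds states at the front of a path, as the
    evolution of a chain started at a given state requires; refining a path by
    its next state adds one at the back. *)
Lemma pathsum_rcons m F :
  pathsum m.+1 F = pathsum m (fun l => \esum_(c in [set: C]) F (rcons l c)).
Proof.
elim: m F => [|m IH] F //=; apply: eq_esum => c _.
exact: (IH (fun l => F (c :: l))).
Qed.

Lemma pathsum_esum (T : choiceType) (I : set T) m (F : T -> seq C -> \bar R) :
  (forall i l, 0 <= F i l) ->
  pathsum m (fun l => \esum_(i in I) F i l) = \esum_(i in I) pathsum m (F i).
Proof.
elim: m F => [|m IH] F F0 //=; rewrite esum_exchange; last first.
  by move=> i c; exact: pathsum_ge0.
by apply: eq_esum => c _; rewrite IH.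
Qed.

Lemma pathsumZ m (k : R) F : (0 <= k)%R -> (forall l, 0 <= F l) ->
  pathsum m (fun l => k%:E * F l) = k%:E * pathsum m F.
Proof.
move=> k0; elim: m F => [|m IH] F F0 //=.
under eq_esum do rewrite IH//.
by rewrite esumZ// => c; exact: pathsum_ge0.
Qed.

Lemma pathsumD m F G : (forall l, 0 <= F l) -> (forall l, 0 <= G l) ->
  pathsum m (fun l => F l + G l) = pathsum m F + pathsum m G.
Proof.
elim: m F G => [|m IH] F G F0 G0 //=.
under eq_esum do rewrite IH//.
by rewrite esumD// => c _; exact: pathsum_ge0.
Qed.

(** The family of cylinder probabilities of a finite measure on sequences. *)
Definition consistent u :=
  (forall l, (0 <= u l)%R) /\
  forall l, \esum_(c in [set: C]) (u (rcons l c))%:E = (u l)%:E.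

Lemma pathsum_consistent m u : consistent u ->
  pathsum m (fun l => (u l)%:E) = (u [::])%:E.
Proof.
move=> [u0 cu]; elim: m => // m IH.
by rewrite pathsum_rcons (eq_pathsum _ cu).
Qed.

Lemma consistentD u v : consistent u -> consistent v ->
  consistent (fun l => (u l + v l)%R).
Proof.
move=> [u0 cu] [v0 cv]; split => [l|l]; first by rewrite addr_ge0.
under eq_esum do rewrite EFinD.
by rewrite esumD ?cu ?cv// => c _; rewrite lee_fin.
Qed.

(** The integral, with respect to the measure with cylinder probabilities [H],
    of the product of the densities of [u] and [v] along paths of length [m]. *)
Definition overlap H u v m : \bar R :=
  pathsum m (fun l => (u l * v l / H l)%:E).

Definition dominated H u (K : R) :=
  (0 <= K)%R /\ forall l, (u l <= K * H l)%R.

Lemma dominated_eq0 H u K l : consistent u -> dominated H u K ->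
  H l = 0%R -> u l = 0%R.
Proof.
move=> [u0 _] [_ uK] Hl; apply/eqP; rewrite eq_le u0 andbT.
by rewrite (le_trans (uK l))// Hl mulr0.
Qed.

Lemma dominatedD H u v K L : dominated H u K -> dominated H v L ->
  dominated H (fun l => (u l + v l)%R) (K + L)%R.
Proof.
move=> [K0 uK] [L0 vL]; split; first by rewrite addr_ge0.
by move=> l; rewrite mulrDl lerD.
Qed.

Lemma overlapC H u v : overlap H u v = overlap H v u.
Proof.
by apply/funext => m; apply: eq_pathsum => l; rewrite [(u l * v l)%R]mulrC.
Qed.

Section Martingales.
Variable H : seq C -> R.
Hypothesis cH : consistent H.

Let H0 l : (0 <= H l)%R. Proof. by case: cH. Qed.

Lemma overlap_term_ge0 u v l : consistent u -> consistent v ->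
  (0 <= u l * v l / H l)%R.
Proof. by move=> [u0 _] [v0 _]; rewrite !mulr_ge0 ?invr_ge0 ?u0 ?v0. Qed.

Lemma overlap_ge0 u v m : consistent u -> consistent v -> 0 <= overlap H u v m.
Proof.
by move=> cu cv; apply: pathsum_ge0 => l; rewrite lee_fin overlap_term_ge0.
Qed.

(** A bounded density may be replaced by its bound under the integral. *)
Lemma overlap_le u v K m : consistent u -> consistent v -> dominated H u K ->
  overlap H u v m <= (K * v [::])%:E.
Proof.
move=> cu cv dK; have [K0 uK] := dK; have [v0 _] := cv.
rewrite EFinM -(pathsum_consistent m cv) -pathsumZ//; apply: le_pathsum => l.
rewrite -EFinM lee_fin.
have [Hl|Hl] := eqVneq (H l) 0%R.
  by rewrite Hl invr0 mulr0 mulr_ge0// ?v0.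
have Hp : (0 < H l)%R by rewrite lt_neqAle eq_sym Hl H0.
by rewrite ler_pdivrMr// mulrAC ler_wpM2r.
Qed.

(** The density of [u] along the paths is a martingale, so its second moment is
    nondecreasing: this is the inequality (E g)^2 <= E (g^2), applied to the
    possible continuations of each path. *)
Lemma overlap_diag_nondecreasing u K : consistent u -> dominated H u K ->
  nondecreasing_seq (overlap H u u).
Proof.
move=> cu dK; have [u0 uE] := cu; have [_ HE] := cH.
apply/nondecreasing_seqP => m; rewrite /overlap pathsum_rcons.
apply: le_pathsum => l.
have [Hl|Hl] := eqVneq (H l) 0%R.
  rewrite Hl invr0 mulr0 esum_ge0// => c _.
  by rewrite lee_fin overlap_term_ge0.
have Hp : (0 < H l)%R by rewrite lt_neqAle eq_sym Hl H0.
(* Each continuation is compared with the tangent, at the density [r] of [l], of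
   the square function. *)
pose r := (u l / H l)%R.
have r0 : (0 <= r)%R by rewrite divr_ge0 ?u0 ?H0.
have : (2 * r)%:E * (u l)%:E <=
    \esum_(c in [set: C]) (u (rcons l c) * u (rcons l c) / H (rcons l c))%:E +
    (r ^+ 2)%:E * (H l)%:E.
  rewrite -HE -uE -esumZ; [|by rewrite mulr_ge0|by move=> c; rewrite lee_fin].
  rewrite -esumZ; [|by rewrite exprn_ge0|by move=> c; rewrite lee_fin].
  rewrite -esumD; last 2 first.
  - by move=> c _; rewrite lee_fin overlap_term_ge0.
  - by move=> c _; rewrite -EFinM lee_fin mulr_ge0// exprn_ge0.
  apply: le_esum => c _; rewrite -!EFinM -EFinD lee_fin.
  move: (rcons l c) => k.
  have [Hk|Hk] := eqVneq (H k) 0%R.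
    by rewrite Hk (dominated_eq0 cu dK Hk) !mulr0 mul0r addr0.
  have Hkp : (0 < H k)%R by rewrite lt_neqAle eq_sym Hk H0.
  rewrite -subr_ge0.
  have -> : (u k * u k / H k + r ^+ 2 * H k - 2 * r * u k =
    (u k - r * H k) ^+ 2 / H k)%R by field.
  by rewrite divr_ge0// exprn_even_ge0.
rewrite -!EFinM.
have -> : (2 * r * u l = u l * u l / H l + r ^+ 2 * H l)%R.
  by rewrite /r; field.
by rewrite EFinD leeD2rE// -EFinM.
Qed.

(** Bounded martingales are bounded in L^2; the product of two of them is
    treated by polarisation. *)
Lemma overlap_cvg u v K L : consistent u -> consistent v ->
  dominated H u K -> dominated H v L ->
  exists l : R, (fun m => fine (overlap H u v m)) @ \oo --> l.
Proof.
move=> cu cv uK vL.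
have fin w w' M m : consistent w -> consistent w' -> dominated H w M ->
    overlap H w w' m \is a fin_num.
  move=> cw cw' wM; rewrite ge0_fin_numE ?overlap_ge0//.
  by apply: le_lt_trans (overlap_le m cw cw' wM) _; rewrite ltry.
have cvg_diag w M : consistent w -> dominated H w M ->
    exists l : R, (fun m => fine (overlap H w w m)) @ \oo --> l.
  move=> cw wM; apply/cvg_ex; apply: nondecreasing_is_cvgn.
    move=> m n mn; apply: fine_le; rewrite ?(fin w w M)//.
    exact: (overlap_diag_nondecreasing cw wM).
  exists (M * w [::])%R => _ [m _ <-].
  by rewrite -lee_fin fineK ?(fin w w M)// overlap_le.
have cuv := consistentD cu cv.
have [a ua] := cvg_diag _ _ cu uK.
have [b vb] := cvg_diag _ _ cv vL.
have [c wc] := cvg_diag _ _ cuv (dominatedD uK vL).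
exists (2^-1 * (c - a - b))%R.
have -> : (fun m => fine (overlap H u v m)) = (fun m => 2^-1 *
    (fine (overlap H (fun l => (u l + v l)%R) (fun l => (u l + v l)%R) m)
     - fine (overlap H u u m) - fine (overlap H v v m)))%R.
  apply/funext => m.
  have -> : overlap H (fun l => (u l + v l)%R) (fun l => (u l + v l)%R) m =
      overlap H u u m + 2%:E * overlap H u v m + overlap H v v m.
    rewrite /overlap -pathsumZ//; last first.
      by move=> l; rewrite lee_fin overlap_term_ge0.
    rewrite -pathsumD; first last.
    - by move=> l; rewrite -EFinM lee_fin mulr_ge0// overlap_term_ge0.
    - by move=> l; rewrite lee_fin overlap_term_ge0.
    rewrite -pathsumD; first last.
    - by move=> l; rewrite lee_fin overlap_term_ge0.
    - move=> l; rewrite -EFinM -EFinD lee_fin.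
      apply: addr_ge0; first exact: overlap_term_ge0.
      by apply: mulr_ge0 => //; exact: overlap_term_ge0.
    by apply: eq_pathsum => l; rewrite -EFinM -!EFinD; congr EFin; ring.
  rewrite -(fineK (fin _ _ _ m cu cu uK)) -(fineK (fin _ _ _ m cv cv vL)).
  rewrite -(fineK (fin _ _ _ m cu cv uK)) -EFinM -!EFinD /=.
  by field.
by apply: cvgM; [exact: cvg_cst|apply: cvgB => //; exact: cvgB].
Qed.

End Martingales.

End PathSums.

(** * Laws of observed paths *)

Section PathLaw.
Context {R : realType} {U V : countType}.
Variables (h : U -> V) (P : U -> U -> R).

(** The probability that a chain with transition matrix [P] started at [x] has
    [h]-image [l] at the times [1, ..., size l]. *)
Fixpoint path_law (x : U) (l : seq V) : R :=
  if l is c :: l' then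
    fine (\esum_(y in h @^-1` [set c]) (P x y * path_law y l')%:E)
  else 1%R.

Hypothesis P_stoch : is_stochastic P.

Let P0 x y : (0 <= P x y)%R. Proof. by case: (P_stoch x). Qed.

Let mean_bounds x (F : U -> R) (I : set U) : (forall y, 0 <= F y <= 1)%R ->
  0 <= \esum_(y in I) (P x y * F y)%:E <= 1.
Proof.
move=> F01; apply/andP; split.
  apply: esum_ge0 => y _; rewrite lee_fin mulr_ge0//.
  by case/andP: (F01 y).
have [_ P1] := P_stoch x; rewrite -P1 esum_mkcond; apply: le_esum => y _.
case: ifP => _; rewrite lee_fin//; case/andP: (F01 y) => _.
exact: ler_piMr.
Qed.

Lemma path_law_bounds x l : (0 <= path_law x l <= 1)%R.
Proof.
elim: l x => [|c l IH] x /=; first by rewrite ler01 lexx.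
case/andP: (mean_bounds x (h @^-1` [set c]) IH) => ge0 le1.
rewrite -!lee_fin fineK ?ge0//.
by rewrite ge0_fin_numE// (le_lt_trans le1)// ltry.
Qed.

Lemma path_law_ge0 x l : (0 <= path_law x l)%R.
Proof. by case/andP: (path_law_bounds x l). Qed.

Lemma path_law_cons x c l : (path_law x (c :: l))%:E =
  \esum_(y in h @^-1` [set c]) (P x y * path_law y l)%:E.
Proof.
case/andP: (mean_bounds x (h @^-1` [set c]) (path_law_bounds^~ l)) => ge0 le1.
by rewrite /= fineK// ge0_fin_numE// (le_lt_trans le1)// ltry.
Qed.

Lemma path_law_consistent x : consistent (path_law x).
Proof.
split; first exact: path_law_ge0.
move=> l; elim: l x => [|c0 l IH] x.
  under eq_esum do rewrite path_law_cons.
  rewrite esum_fibersT; last by move=> y; rewrite lee_fin mulr_ge0.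
  by have [_ <-] := P_stoch x; apply: eq_esum => y _; rewrite mulr1.
under eq_esum do rewrite rcons_cons path_law_cons.
rewrite esum_exchange; last first.
  by move=> c y; rewrite lee_fin mulr_ge0// path_law_ge0.
rewrite path_law_cons; apply: eq_esum => y _.
under eq_esum do rewrite EFinM.
rewrite esumZ//; last by move=> c; rewrite lee_fin path_law_ge0.
by rewrite IH EFinM.
Qed.

End PathLaw.

Section Observation.
Context {R : realType} {V : countType}.
Variable Q : V -> V -> R.
Hypothesis Q_stoch : is_stochastic Q.

Lemma path_law_id_cons c c' l :
  path_law id Q c (c' :: l) = (Q c c' * path_law id Q c' l)%R.
Proof.
apply: EFin_inj; rewrite path_law_cons// preimage_id esum_set1//.
by rewrite lee_fin mulr_ge0 ?path_law_ge0//; case: (Q_stoch c).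
Qed.

(** The kernels of an exact lumping disintegrate the law of the lumped chain:
    started from [nu c], the chain observed through [h] is Markov. *)
Lemma path_law_mixture (U : countType) (h : U -> V) (P : U -> U -> R)
    (nu : V -> U -> R) : is_stochastic P ->
  (forall c, is_distribution (nu c) /\ forall x, h x <> c -> nu c x = 0%R) ->
  (forall c c' x', h x' = c' ->
    \esum_(x in h @^-1` [set c]) (nu c x * P x x')%:E =
    (Q c c' * nu c' x')%:E) ->
  forall c l, \esum_(x in h @^-1` [set c]) (nu c x * path_law h P x l)%:E =
              (path_law id Q c l)%:E.
Proof.
move=> P_stoch nuD nuP.
have nu0 c x : (0 <= nu c x)%R by case: (nuD c) => -[].
have P0 x y : (0 <= P x y)%R by case: (P_stoch x).
move=> c l; elim: l c => [|c' l IH] c.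
  have [[_ <-] nus] := nuD c.
  rewrite (@esum_support _ _ _ [set: U])//; last first.
    by move=> x _ hx; rewrite nus ?mul0r.
  by apply: eq_esum => x _; rewrite mulr1.
transitivity (\esum_(x in h @^-1` [set c]) \esum_(y in h @^-1` [set c'])
    (nu c x * P x y * path_law h P y l)%:E).
  apply: eq_esum => x _; rewrite EFinM path_law_cons// -esumZ//.
    by apply: eq_esum => y _; rewrite -EFinM mulrA.
  by move=> y; rewrite lee_fin mulr_ge0// path_law_ge0.
rewrite esum_exchange; last first.
  by move=> x y; rewrite lee_fin !mulr_ge0// path_law_ge0.
rewrite path_law_id_cons EFinM -IH -esumZ; last 2 first.
- by case: (Q_stoch c).
- by move=> x; rewrite lee_fin mulr_ge0// path_law_ge0.
apply: eq_esum => y hy.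
under eq_esum do rewrite mulrC EFinM.
rewrite esumZ ?path_law_ge0//; last by move=> x; rewrite lee_fin mulr_ge0.
by rewrite (nuP _ c')// -!EFinM mulrC mulrA.
Qed.

End Observation.

(** * Cylinder events of a Markov chain *)

Section CountableAdditivity.
Context {R : realType} {d : measure_display} {O : measurableType d}.
Variable mu : {measure set O -> \bar R}.

Lemma measure_bigcup_countType (T : countType) (I : set T) (E : T -> set O) :
  (forall i, measurable (E i)) -> trivIset I E ->
  mu (\bigcup_(i in I) E i) = \esum_(i in I) mu (E i).
Proof.
move=> mE tE.
pose E' n := oapp E set0 (@pickle_inv T n).
have -> : \bigcup_(i in I) E i = \bigcup_(n in pickle @` I) E' n.
  apply/seteqP; split => [w [i Ii Ei]|w [_ [i Ii <-]]].
    by exists (pickle i); [exists i|rewrite /E' pickleK_inv].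
  by rewrite /E' pickleK_inv; exists i.
rewrite measure_bigcup; last 2 first.
- by move=> n _; rewrite /E'; case: pickle_inv => //=.
- move=> _ _ [i Ii <-] [j Ij <-]; rewrite /E' !pickleK_inv/= => ij.
  by rewrite (tE i j).
rewrite nneseries_esum//.
have -> : [set n | n \in pickle @` I] = pickle @` I by apply: set_mem_set.
rewrite esum_image; last by move=> i j _ _; exact: (pcan_inj pickleK).
by apply: eq_esum => i _; rewrite /E' pickleK_inv.
Qed.

End CountableAdditivity.

Section PathEvents.
Context {U : countType}.

Definition path_past t (x : nat -> U) : set (nat -> U) :=
  [set z | forall s, (s <= t)%N -> z s = x s].

Fixpoint path_future {V : Type} (h : U -> V) t (l : seq V) : set (nat -> U) :=
  if l is c :: l' then
    [set z | h (z t.+1) = c] `&` path_future h t.+1 l'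
  else setT.

Lemma path_measurableT : path_measurable [set: nat -> U].
Proof.
have [s0 sC _] := @smallest_sigma_algebra (nat -> U) setT
  [set E | exists t (F : set U), E = [set x | F (x t)]].
by have := sC _ s0; rewrite setD0.
Qed.

Lemma path_measurableI (E F : set (nat -> U)) :
  path_measurable E -> path_measurable F -> path_measurable (E `&` F).
Proof.
move=> mE mF.
have [s0 sC sU] := @smallest_sigma_algebra (nat -> U) setT
  [set E | exists t (F : set U), E = [set x | F (x t)]].
have -> : E `&` F = setT `\` \bigcup_k (bigcup2 (setT `\` E) (setT `\` F) k).
  by rewrite bigcup2E !setTD setCU !setCK.
apply: (sC); apply: (sU) => -[|[|n]] /=; [exact: sC|exact: sC|exact: s0].
Qed.

Lemma path_measurable_at t (F : set U) : path_measurable [set x | F (x t)].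
Proof. by apply: sub_gen_smallest; exists t, F. Qed.

Lemma path_past_measurable t x : path_measurable (path_past t x).
Proof.
elim: t => [|t IH].
  have -> : path_past 0 x = [set z | [set x 0%N] (z 0%N)].
    apply/seteqP; split => z /=; first by apply.
    by move=> zx s; rewrite leqn0 => /eqP ->.
  exact: path_measurable_at.
have -> : path_past t.+1 x =
    path_past t x `&` [set z | [set x t.+1] (z t.+1)].
  apply/seteqP; split => z /=.
    by move=> zx; split; [move=> s st; apply: zx; exact: leqW|exact: zx].
  by move=> [zx zt] s; rewrite leq_eqVlt => /predU1P[->//|]; exact: zx.
by apply: path_measurableI => //; exact: path_measurable_at.
Qed.

Lemma path_future_measurable (V : Type) (h : U -> V) t l :
  path_measurable (path_future h t l).
Proof.
elim: l t => [|c l IH] t /=; first exact: path_measurableT.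
apply: path_measurableI => //.
exact: (path_measurable_at t.+1 (h @^-1` [set c])).
Qed.

Lemma path_measurable_preimage d (O : measurableType d) (X : nat -> O -> U) :
  (forall t F, measurable (X t @^-1` F)) ->
  forall E, path_measurable E -> measurable [set w | E (X ^~ w)].
Proof.
move=> mX E; apply: (@smallest_sub _ _ _
  [set E | measurable [set w | E (X ^~ w)]]); last first.
  by move=> _ [t [F ->]]; exact: mX.
split => /=.
- exact: measurable0.
- move=> A mA; have -> : [set w | (setT `\` A) (X ^~ w)] =
      ~` [set w | A (X ^~ w)] by rewrite setTD.
  exact: measurableC.
- move=> F mF; change (measurable (\bigcup_k [set w | F k (X ^~ w)])).
  exact: bigcupT_measurable.
Qed.

End PathEvents.

Section MarkovChainPaths.
Context {R : realType} {U : countType} {d : measure_display}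
  {O : measurableType d}.
Variables (Pr : probability O R) (X : nat -> O -> U) (a : U -> R)
  (P : U -> U -> R).
Hypothesis hX : markov_chain Pr X a P.

Let P_stoch : is_stochastic P. Proof. by case: hX => -[]. Qed.

Let mX E : path_measurable E -> measurable [set w | E (X ^~ w)].
Proof. by case: hX => _ mX _ _; exact: path_measurable_preimage. Qed.

Let mpast t x : measurable [set w | path_past t x (X ^~ w)].
Proof. exact: (mX (path_past_measurable t x)). Qed.

Lemma markov_past_future (V : countType) (h : U -> V) t x l :
  Pr [set w | (path_past t x `&` path_future h t l) (X ^~ w)] =
  Pr [set w | path_past t x (X ^~ w)] * (path_law h P (x t) l)%:E.
Proof.
elim: l t x => [|c l IH] t x; first by rewrite setIT mule1.
pose upd y s := if (s <= t)%N then x s else y.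
have updS y : upd y t.+1 = y by rewrite /upd ltnn.
have past_upd y z : path_past t.+1 (upd y) z <-> path_past t x z /\ z t.+1 = y.
  split => [zy|[zx zy] s].
    split=> [s st|]; last by rewrite zy.
    by rewrite zy ?leqW// /upd st.
  rewrite leq_eqVlt => /predU1P[->|st]; first by rewrite updS.
  by rewrite zx// /upd -ltnS st.
pose E y :=
  [set w | (path_past t.+1 (upd y) `&` path_future h t.+1 l) (X ^~ w)].
have -> : [set w | (path_past t x `&` path_future h t (c :: l)) (X ^~ w)] =
    \bigcup_(y in h @^-1` [set c]) E y.
  apply/seteqP; split => w /=.
    move=> [wx [wc wl]]; exists (X t.+1 w) => //; split => //.
    exact/past_upd.
  by move=> [y hy [/past_upd[wx wy] wl]]; split => //; split => //=; rewrite wy.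
rewrite measure_bigcup_countType; last 2 first.
- move=> y; apply: mX; apply: path_measurableI.
    exact: path_past_measurable.
  exact: path_future_measurable.
- by move=> y y' _ _ [w [[/past_upd[_ <-] _] [/past_upd[_ <-] _]]].
rewrite (eq_esum (fun y _ => IH t.+1 (upd y))).
set past := [set w | path_past t x (X ^~ w)].
have pE : (fine (Pr past))%:E = Pr past.
  by rewrite fineK// fin_num_measure//; exact: mpast.
rewrite path_law_cons// -pE -esumZ; last 2 first.
- exact/fine_ge0.
- move=> y; rewrite lee_fin mulr_ge0 ?path_law_ge0//.
  by case: (P_stoch (x t)) => + _; apply.
apply: eq_esum => y _; rewrite pE updS EFinM muleA; congr (_ * _).
have [_ _ _ step] := hX.
have := step t (upd y); rewrite updS [upd y t]/upd leqnn => {}step.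
rewrite [LHS]step; congr (Pr _ * _).
apply/seteqP; split => w /= wx s st; have := wx s st.
  by rewrite /upd st.
by rewrite /upd st.
Qed.

(** A visited state is visited along some finite history of positive
    probability, because there are only countably many histories. *)
Lemma visited_past x : ~ never_visited Pr X x ->
  exists t z, z t = x /\ 0 < Pr [set w | path_past t z (X ^~ w)].
Proof.
apply: contra_notP => none.
(* A history of length [size l] ending in [x] is the sequence [l] followed by
   the default value [x]. *)
pose E (l : seq U) := [set w | path_past (size l) (nth x l) (X ^~ w)].
have E0 l : Pr (E l) = 0.
  apply/eqP; rewrite -measure_le0 leNgt; apply/negP => pos.
  by apply: none; exists (size l), (nth x l); rewrite nth_default.
pose E' n := oapp E set0 (@pickle_inv (seq U) n).
apply: (@negligibleS _ _ _ _ (\bigcup_n E' n)); last first.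
  apply: negligible_bigcup => n; rewrite /E'; case: pickle_inv => [l|] /=.
    by apply/negligibleP; [exact: mpast|exact: E0].
  exact: negligible_set0.
move=> w /= /existsNP[t /contrapT Xt].
pose l := [seq X s w | s <- iota 0 t].
exists (pickle l) => //; rewrite /E' pickleK_inv /= /E /= size_map size_iota.
move=> s; rewrite leq_eqVlt => /predU1P[->|st].
  by rewrite nth_default// size_map size_iota.
by rewrite (nth_map 0%N) ?size_iota// nth_iota.
Qed.

End MarkovChainPaths.

(** If [g(Y)] has the law of a Markov chain [Z], then the future of [g(Y)] seen
    from a state [y] which [Y] visits has a bounded density with respect to the
    future of [Z]: one compares, along one history of positive probability
    leading to [y], the joint law of [Y] and of its image with that of [Z]. *)
Lemma observed_dominated (R : realType) (B C : countType)
    (dY dZ : measure_display) (OY : measurableType dY) (OZ : measurableType dZ)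
    (PrY : probability OY R) (PrZ : probability OZ R)
    (Y : nat -> OY -> B) (Z : nat -> OZ -> C)
    (aY : B -> R) (PY : B -> B -> R) (aZ : C -> R) (PZ : C -> C -> R)
    (g : B -> C) (y : B) :
  markov_chain PrY Y aY PY -> markov_chain PrZ Z aZ PZ ->
  equal_in_law PrZ Z PrY (fun t w => g (Y t w)) -> ~ never_visited PrY Y y ->
  exists K, dominated (path_law id PZ (g y)) (path_law g PY y) K.
Proof.
move=> hY hZ hgY /(visited_past hY)[t [x [<- {y} pos]]].
have [[_ PY_stoch] mY _ _] := hY; have [[_ PZ_stoch] mZ _ _] := hZ.
have mpast : measurable [set w | path_past t x (Y ^~ w)].
  by apply: path_measurable_preimage => //; exact: path_past_measurable.
set p := PrY _ in pos.
have pE : (fine p)%:E = p by rewrite fineK// fin_num_measure.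
have p0 : (0 < fine p)%R by rewrite -lte_fin pE.
exists (fine p)^-1%R; split => [|l]; first by rewrite invr_ge0 ltW.
rewrite mulrC ler_pdivlMr// mulrC -lee_fin EFinM pE.
rewrite -(markov_past_future hY).
have futE s k z : path_future g s k z <-> path_future id s k (fun i => g (z i)).
  elim: k s => [|c k IH] s //=.
  by split => -[zc /IH zk]; split.
pose E := path_past t (fun s => g (x s)) `&` path_future id t l.
have mE : path_measurable E.
  by apply: path_measurableI; [exact: path_past_measurable|
    exact: path_future_measurable].
apply: (@le_trans _ _ (PrY [set w | E (fun s => g (Y s w))])).
  apply: le_measure; rewrite ?inE.
  - apply: path_measurable_preimage => //; apply: path_measurableI.
      exact: path_past_measurable.
    exact: path_future_measurable.
  - apply: (@path_measurable_preimage _ _ _ (fun s w => g (Y s w))) => // s F.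
    exact: (mY s (g @^-1` F)).
  - move=> w /= [wx /futE wl]; split => // s st /=.
    by rewrite (wx s st).
rewrite -(hgY _ mE) (markov_past_future hZ) -[leRHS]mul1e.
apply: lee_wpmul2r; first by rewrite lee_fin path_law_ge0.
by apply: probability_le1; apply: path_measurable_preimage => //;
  exact: path_past_measurable.
Qed.

(** * The coupling of two chains with a common image *)

Section CouplingSums.
Context {R : realType} {A B C : countType}.
Variables (f : A -> C) (g : B -> C).

Lemma fstD_sndD (p : Delta f g) : f (fstD p) = g (sndD p).
Proof. exact: (eqP (valP p)). Qed.

Lemma Delta_eq (p q : Delta f g) :
  fstD p = fstD q -> sndD p = sndD q -> p = q.
Proof.
move: p q => [[a b] ab] [[a' b'] ab'] /= aa bb.
by apply/val_inj => /=; congr pair.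
Qed.

Lemma esum_sndD b (k : A -> B -> \bar R) :
  \esum_(p in @sndD _ _ _ f g @^-1` [set b]) k (fstD p) (sndD p) =
  \esum_(a in f @^-1` [set g b]) k a b.
Proof.
rewrite (reindex_esum (@sndD _ _ _ f g @^-1` [set b]) _ (@fstD _ _ _ f g)).
  by apply: eq_esum => p <-.
split => [p /= <-|p q|a /= fa].
- exact: fstD_sndD.
- by rewrite !inE/= => pb qb pq; apply: Delta_eq => //; rewrite pb.
- by exists (exist _ (a, b) (introT eqP fa)).
Qed.

Lemma esum_Delta (k : A -> B -> \bar R) : (forall a b, 0 <= k a b) ->
  \esum_(p in [set: Delta f g]) k (fstD p) (sndD p) =
  \esum_(c in [set: C]) \esum_(a in f @^-1` [set c])
    \esum_(b in g @^-1` [set c]) k a b.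
Proof.
move=> k0; rewrite -(esum_fibersT (@sndD _ _ _ f g))//.
rewrite -(esum_fibersT g); last by move=> b; exact: esum_ge0.
apply: eq_esum => c _; rewrite [RHS]esum_exchange//; apply: eq_esum => b <-.
exact: esum_sndD.
Qed.

End CouplingSums.

Section Coupling.
Context {R : realType} {A B C : countType}.
Variables (f : A -> C) (g : B -> C).
Variables (PX : A -> A -> R) (PY : B -> B -> R) (PZ : C -> C -> R).
Hypotheses (PX_stoch : is_stochastic PX) (PY_stoch : is_stochastic PY)
  (PZ_stoch : is_stochastic PZ).

Let PX0 a a' : (0 <= PX a a')%R. Proof. by case: (PX_stoch a). Qed.
Let PY0 b b' : (0 <= PY b b')%R. Proof. by case: (PY_stoch b). Qed.
Let PZ0 c c' : (0 <= PZ c c')%R. Proof. by case: (PZ_stoch c). Qed.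

Local Notation D := (Delta f g).
Local Notation M := (@Rmat R A B C f g PX PY PZ).
Local Notation F := (path_law f PX).
Local Notation G := (path_law g PY).
Local Notation H := (path_law id PZ).

Lemma RmatE (p q : D) : M p q = (PX (fstD p) (fstD q) *
  PY (sndD p) (sndD q) / PZ (g (sndD p)) (g (sndD q)))%R.
Proof.
rewrite /Rmat !fstD_sndD; case: ltP => // PZ_le0.
have -> : PZ (g (sndD p)) (g (sndD q)) = 0%R.
  by apply/eqP; rewrite eq_le PZ_le0 PZ0.
by rewrite invr0 mulr0.
Qed.

Lemma Rmat_ge0 (p q : D) : (0 <= M p q)%R.
Proof. by rewrite RmatE !mulr_ge0// invr_ge0. Qed.

Let ov a b m := overlap (H (g b)) (F a) (G b) m.

Let ov_ge0 a b m : 0 <= ov a b m.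
Proof. by apply: overlap_ge0; exact: path_law_consistent. Qed.

(** Conditioning the overlap on the first step of both chains. *)
Lemma overlapS (p : D) m :
  \esum_(q in [set: D]) ((M p q)%:E * ov (fstD q) (sndD q) m) =
  ov (fstD p) (sndD p) m.+1.
Proof.
pose a := fstD p; pose b := sndD p.
pose k a' b' := (PX a a' * PY b b' / PZ (g b) (g b'))%:E * ov a' b' m.
have k0 a' b' : 0 <= k a' b'.
  by rewrite mule_ge0// lee_fin !mulr_ge0// invr_ge0.
transitivity (\esum_(q in [set: D]) k (fstD q) (sndD q)).
  by apply: eq_esum => q _; rewrite RmatE.
rewrite esum_Delta//; apply: eq_esum => c _ /=.
have F0 x l : (0 <= F x l)%R by exact: path_law_ge0.
have G0 x l : (0 <= G x l)%R by exact: path_law_ge0.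
have H0 x l : (0 <= H x l)%R by exact: path_law_ge0.
(* The contribution of the first steps to [a'] and [b'] followed by the observed
   path [l]. *)
pose t a' b' l := ((PZ (g b) c * H c l)^-1 *
  (PX a a' * F a' l) * (PY b b' * G b' l))%:E.
have t0 a' b' l : 0 <= t a' b' l.
  by rewrite lee_fin !mulr_ge0// invr_ge0 mulr_ge0.
transitivity (\esum_(a' in f @^-1` [set c]) \esum_(b' in g @^-1` [set c])
    pathsum m (t a' b')).
  apply: eq_esum => a' _; apply: eq_esum => b' gb'.
  rewrite /k /ov /overlap -pathsumZ; last 2 first.
  - by rewrite !mulr_ge0// invr_ge0.
  - by move=> l; rewrite lee_fin !mulr_ge0// invr_ge0.
  apply: eq_pathsum => l; rewrite -EFinM gb' /t; congr EFin.
  by rewrite invfM; ring.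
under eq_esum do rewrite -pathsum_esum//.
rewrite -pathsum_esum; last by move=> i l; exact: esum_ge0.
apply: eq_pathsum => l.
have -> : (F a (c :: l) * G b (c :: l) / H (g b) (c :: l))%:E =
    ((H (g b) (c :: l))^-1 * G b (c :: l))%:E * (F a (c :: l))%:E.
  by rewrite -EFinM; congr EFin; ring.
rewrite [in RHS]path_law_cons// -esumZ; last 2 first.
- by rewrite mulr_ge0// invr_ge0.
- by move=> a'; rewrite lee_fin mulr_ge0.
apply: eq_esum => a' _; rewrite path_law_id_cons// /t.
under eq_esum do rewrite EFinM.
rewrite esumZ; last 2 first.
- by rewrite !mulr_ge0// invr_ge0 mulr_ge0.
- by move=> b'; rewrite lee_fin mulr_ge0.
by rewrite -path_law_cons// -!EFinM; congr EFin; ring.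
Qed.

Lemma matrix_power_overlap (p : D) m :
  \esum_(q in [set: D]) matrix_power M m p q = ov (fstD p) (sndD p) m.
Proof.
elim: m p => [|m IH] p /=.
  rewrite -(@esum_support _ _ [set p])//; last first.
    by move=> q _ /eqP; rewrite eq_sym => /negbTE ->.
  by rewrite esum_set1 ?lee_fin// eqxx /ov /overlap /= divr1 mulr1.
have M0 n (q r : D) : 0 <= matrix_power M n q r.
  elim: n q r => [|n IHn] q r /=; first by rewrite lee_fin.
  by apply: esum_ge0 => z _; rewrite mule_ge0// lee_fin Rmat_ge0.
rewrite esum_exchange; last first.
  by move=> q z; rewrite mule_ge0// lee_fin Rmat_ge0.
rewrite -overlapS; apply: eq_esum => z _.
by rewrite esumZ ?Rmat_ge0// IH.
Qed.

Variable nu : C -> A -> R.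
Hypotheses (nu_dist : forall c, is_distribution (nu c) /\
    forall a, f a <> c -> nu c a = 0%R)
  (nu_gt0 : forall a, (0 < nu (f a) a)%R)
  (nu_PX : forall c c' a', f a' = c' ->
    \esum_(a in f @^-1` [set c]) (nu c a * PX a a')%:E =
    (PZ c c' * nu c' a')%:E)
  (G_dom : forall b, exists K, dominated (H (g b)) (G b) K).

Let nu0 c a : (0 <= nu c a)%R. Proof. by case: (nu_dist c) => -[]. Qed.

Lemma nu_fiber c : \esum_(a in f @^-1` [set c]) (nu c a)%:E = 1.
Proof.
have [[_ <-] nu_supp] := nu_dist c; apply: esum_support => // a _ fa.
by rewrite nu_supp.
Qed.

(** [F a] is one of the components, with weight [nu (f a) a], of the mixture
    [H (f a)]. *)
Lemma F_dom a : dominated (H (f a)) (F a) (nu (f a) a)^-1.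
Proof.
split => [|l]; first by rewrite invr_ge0.
rewrite mulrC ler_pdivlMr// mulrC -lee_fin.
rewrite -(path_law_mixture PZ_stoch PX_stoch nu_dist nu_PX).
apply: (@esum_ge_term _ _ _ (fun a' => (nu (f a) a' * F a' l)%:E)) => //.
by rewrite lee_fin mulr_ge0// path_law_ge0.
Qed.

Lemma ov_fin a b m : ov a b m \is a fin_num.
Proof.
have [K KG] := G_dom b.
rewrite ge0_fin_numE//; apply: le_lt_trans (ltry (K * F a [::])%R).
rewrite /ov overlapC; apply: overlap_le => //; exact: path_law_consistent.
Qed.

(** [phi] as a real function of all pairs, so that the sums over the fibres of
    [f] and [g] need no proof of membership in [Delta]. *)
Definition psi a b : R := lim ((fun m => fine (ov a b m)) @ \oo).

Lemma ov_cvg a b : f a = g b -> (fun m => fine (ov a b m)) @ \oo --> psi a b.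
Proof.
move=> ab; have [K KG] := G_dom b.
have := F_dom a; rewrite ab => aF.
have [l ovl] := overlap_cvg (path_law_consistent id PZ_stoch (g b))
  (path_law_consistent f PX_stoch a) (path_law_consistent g PY_stoch b) aF KG.
by rewrite /psi (cvg_lim _ ovl).
Qed.

Lemma ov_cvgE a b : f a = g b -> ov a b @ \oo --> (psi a b)%:E.
Proof.
move=> ab; apply: cvg_EFin; first by apply: nearW => m; exact: ov_fin.
exact: ov_cvg.
Qed.

Lemma phiE (p : D) : @phi R A B C f g PX PY PZ p = (psi (fstD p) (sndD p))%:E.
Proof.
rewrite /phi (_ : (fun m => _) = ov (fstD p) (sndD p)); last first.
  by apply/funext => m; exact: matrix_power_overlap.
exact/cvg_lim/ov_cvgE/fstD_sndD.
Qed.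

Lemma psi_ge0 a b : f a = g b -> (0 <= psi a b)%R.
Proof.
move=> ab; rewrite -lee_fin; apply: (cvge_ge _ (ov_cvgE ab)).
by apply: nearW => m; exact: ov_ge0.
Qed.

(** At each finite time the overlap has [nu]-mean one; the limit is taken under
    the sum because the overlaps with the future of [b] are bounded, which
    makes Fatou's lemma apply to them and to their distance to the bound. *)
Lemma psi_mean b :
  \esum_(a in f @^-1` [set g b]) (nu (g b) a * psi a b)%:E = 1.
Proof.
have [K KG] := G_dom b; have [K0 GK] := KG.
have Fc a := path_law_consistent f PX_stoch a.
have Gc := path_law_consistent g PY_stoch b.
have Hc := path_law_consistent id PZ_stoch (g b).
have ovK a m : (fine (ov a b m) <= K)%R.
  rewrite -lee_fin fineK ?ov_fin//.
  by rewrite -[K]mulr1 /ov overlapC; exact: overlap_le.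
have ovf0 a m : (0 <= fine (ov a b m))%R by rewrite fine_ge0.
have mean m :
    \esum_(a in f @^-1` [set g b]) (nu (g b) a * fine (ov a b m))%:E = 1.
  transitivity (\esum_(a in f @^-1` [set g b])
      pathsum m (fun l => (nu (g b) a * (F a l * G b l / H (g b) l))%:E)).
    apply: eq_esum => a _.
    rewrite EFinM fineK ?ov_fin// /ov /overlap -pathsumZ//.
    by move=> l; rewrite lee_fin overlap_term_ge0.
  rewrite -pathsum_esum; last first.
    by move=> a l; rewrite lee_fin mulr_ge0// overlap_term_ge0.
  transitivity (pathsum m (fun l => (G b l)%:E)); last first.
    by rewrite pathsum_consistent.
  apply: eq_pathsum => l.
  transitivity ((G b l / H (g b) l)%:E * (H (g b) l)%:E).
    rewrite -(path_law_mixture PZ_stoch PX_stoch nu_dist nu_PX).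
    rewrite -esumZ; last 2 first.
    - by rewrite divr_ge0 ?path_law_ge0.
    - by move=> a; rewrite lee_fin mulr_ge0// path_law_ge0.
    by apply: eq_esum => a _; rewrite -EFinM; congr EFin; ring.
  rewrite -EFinM; congr EFin.
  have [H0|H0] := eqVneq (H (g b) l) 0%R; last by field.
  by rewrite H0 mulr0 (dominated_eq0 Gc KG H0).
apply/eqP; rewrite eq_le; apply/andP; split.
  apply: (@esum_fatou _ _ _ (fun m a => nu (g b) a * fine (ov a b m))%R
    _ (cst 1)).
  - by move=> m a _; rewrite mulr_ge0.
  - by move=> a fa; apply: cvgM; [exact: cvg_cst|exact: ov_cvg].
  - by move=> m; rewrite mean.
  - exact: cvg_cst.
have psiK a : f a = g b -> (psi a b <= K)%R.
  move=> ab; rewrite -lee_fin; apply: (cvge_le _ (ov_cvgE ab)).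
  by apply: nearW => m; rewrite -(fineK (ov_fin a b m)) lee_fin.
have split_mean (w : A -> R) : (forall a, f a = g b -> 0 <= w a <= K)%R ->
    \esum_(a in f @^-1` [set g b]) (nu (g b) a * (K - w a))%:E +
    \esum_(a in f @^-1` [set g b]) (nu (g b) a * w a)%:E = K%:E.
  move=> wK; rewrite -esumD; last 2 first.
  - by move=> a /wK /andP[_ ?]; rewrite lee_fin mulr_ge0// subr_ge0.
  - by move=> a /wK /andP[? _]; rewrite lee_fin mulr_ge0.
  rewrite -[RHS]mule1 -(nu_fiber (g b)) -esumZ//; last first.
    by move=> a; rewrite lee_fin.
  by apply: eq_esum => a _; rewrite -EFinD -EFinM; congr EFin; ring.
have cofatou : \esum_(a in f @^-1` [set g b]) (nu (g b) a * (K - psi a b))%:E <=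
    (K - 1)%:E.
  apply: (@esum_fatou _ _ _ (fun m a => nu (g b) a * (K - fine (ov a b m)))%R
    _ (cst (K - 1)%:E)).
  - by move=> m a _; rewrite mulr_ge0// subr_ge0.
  - move=> a fa; apply: cvgM; first exact: cvg_cst.
    by apply: cvgB; [exact: cvg_cst|exact: ov_cvg].
  - move=> m; have ovfK a : f a = g b -> (0 <= fine (ov a b m) <= K)%R.
      by rewrite ovf0 ovK.
    have := split_mean _ ovfK; rewrite mean => sumK.
    by rewrite EFinB leeBrDr// [leLHS]sumK.
  - exact: cvg_cst.
have psi0K a : f a = g b -> (0 <= psi a b <= K)%R.
  by move=> ab; rewrite psi_ge0//= psiK.
have sumK := split_mean (psi^~ b) psi0K.
have : K%:E <= (K - 1)%:E +
    \esum_(a in f @^-1` [set g b]) (nu (g b) a * psi a b)%:E.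
  by rewrite -[leLHS]sumK leeD2r.
by rewrite -leeBlDl// -EFinB opprB addrC subrK.
Qed.

(** A step of [Y] observed as an impossible step of [Z] is impossible, so the
    division by [PZ] in [R] loses nothing on the side of [Y]. *)
Lemma PY_eq0 b b' : PZ (g b) (g b') = 0%R -> PY b b' = 0%R.
Proof.
move=> PZ_eq0; have [K KG] := G_dom b.
apply/eqP; rewrite eq_le PY0 andbT.
have H_eq0 : H (g b) [:: g b'] = 0%R by rewrite path_law_id_cons// PZ_eq0 mul0r.
rewrite -(dominated_eq0 (path_law_consistent g PY_stoch b) KG H_eq0) -lee_fin.
rewrite path_law_cons//; under eq_esum do rewrite mulr1.
by apply: (@esum_ge_term _ _ _ (fun y => (PY b y)%:E)) => //; rewrite lee_fin.
Qed.

(** The exact lumping property of [f] turns into one of the second projection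
    for the unnormalised matrix [R]. *)
Lemma nu_Rmat b (q : D) :
  \esum_(p in @sndD _ _ _ f g @^-1` [set b]) (nu (g b) (fstD p) * M p q)%:E =
  (PY b (sndD q) * nu (g (sndD q)) (fstD q))%:E.
Proof.
pose b' := sndD q; pose a' := fstD q.
transitivity (\esum_(p in @sndD _ _ _ f g @^-1` [set b])
    (nu (g b) (fstD p) * (PX (fstD p) a' * PY b b' / PZ (g b) (g b')))%:E).
  by apply: eq_esum => p <-; rewrite RmatE.
rewrite (esum_sndD f g b
  (fun a _ => (nu (g b) a * (PX a a' * PY b b' / PZ (g b) (g b')))%:E)).
transitivity (\esum_(a in f @^-1` [set g b])
    ((PY b b' / PZ (g b) (g b'))%:E * (nu (g b) a * PX a a')%:E)).
  by apply: eq_esum => a _; rewrite -EFinM; congr EFin; ring.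
rewrite esumZ ?divr_ge0//; last by move=> a; rewrite lee_fin mulr_ge0.
rewrite (nu_PX _ (fstD_sndD q)) -EFinM; congr EFin.
have [PZ_eq0|PZ_neq0] := eqVneq (PZ (g b) (g b')) 0%R; last by field.
by rewrite PZ_eq0 (PY_eq0 PZ_eq0) !mul0r.
Qed.

Let nu_pair_ge0 b (p : D) : (0 <= nu (g b) (fstD p) * psi (fstD p) (sndD p))%R.
Proof. by rewrite mulr_ge0// psi_ge0// fstD_sndD. Qed.

Lemma psi_mean_sndD b : \esum_(p in @sndD _ _ _ f g @^-1` [set b])
  (nu (g b) (fstD p) * psi (fstD p) (sndD p))%:E = 1.
Proof.
by rewrite (esum_sndD f g b (fun a b' => (nu (g b) a * psi a b')%:E)) psi_mean.
Qed.

(** [R phi <= phi] by Fatou's lemma, and both sides have the same [nu]-mean over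
    the fibre of [b]; as [nu] charges every state, they are equal. *)
Lemma psi_harmonic (p : D) :
  \esum_(q in [set: D]) (M p q * psi (fstD q) (sndD q))%:E =
  (psi (fstD p) (sndD p))%:E.
Proof.
have Mpsi0 (r q : D) : (0 <= M r q * psi (fstD q) (sndD q))%R.
  by rewrite mulr_ge0 ?Rmat_ge0// psi_ge0// fstD_sndD.
have excessive (r : D) :
    \esum_(q in [set: D]) (M r q * psi (fstD q) (sndD q))%:E <=
    (psi (fstD r) (sndD r))%:E.
  apply: (@esum_fatou _ _ _ (fun m q => M r q * fine (ov (fstD q) (sndD q) m))%R
    _ (fun m => ov (fstD r) (sndD r) m.+1)).
  - by move=> m q _; rewrite mulr_ge0 ?Rmat_ge0// fine_ge0.
  - move=> q _; apply: cvgM; first exact: cvg_cst.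
    exact/ov_cvg/fstD_sndD.
  - move=> m; rewrite -overlapS; apply: le_esum => q _.
    by rewrite EFinM fineK ?ov_fin.
  - have := ov_cvgE (fstD_sndD r).
    by rewrite -(@cvg_shiftS _ (ov (fstD r) (sndD r))).
pose b := sndD p.
pose S r := \esum_(q in [set: D]) (M r q * psi (fstD q) (sndD q))%:E.
have nuS : \esum_(r in @sndD _ _ _ f g @^-1` [set b])
    ((nu (g b) (fstD r))%:E * S r) = 1.
  transitivity (\esum_(r in @sndD _ _ _ f g @^-1` [set b])
      \esum_(q in [set: D])
      ((psi (fstD q) (sndD q))%:E * (nu (g b) (fstD r) * M r q)%:E)).
    apply: eq_esum => r _; rewrite -esumZ//; last first.
      by move=> q; rewrite lee_fin Mpsi0.
    by apply: eq_esum => q _; rewrite -!EFinM; congr EFin; ring.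
  rewrite esum_exchange; last first.
    move=> r q; rewrite -EFinM lee_fin !mulr_ge0 ?Rmat_ge0//.
    by rewrite psi_ge0// fstD_sndD.
  transitivity (\esum_(q in [set: D]) ((PY b (sndD q))%:E *
      (nu (g (sndD q)) (fstD q) * psi (fstD q) (sndD q))%:E)).
    apply: eq_esum => q _; rewrite esumZ; last 2 first.
    - by rewrite psi_ge0// fstD_sndD.
    - by move=> r; rewrite lee_fin mulr_ge0 ?Rmat_ge0.
    by rewrite nu_Rmat -!EFinM; congr EFin; ring.
  rewrite -(esum_fibersT (@sndD _ _ _ f g)); last first.
    by move=> q; rewrite mule_ge0// lee_fin.
  have [_ <-] := PY_stoch b; apply: eq_esum => b' _.
  rewrite -[RHS]mule1 -(psi_mean_sndD b') -esumZ//; last first.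
    by move=> q; rewrite lee_fin nu_pair_ge0.
  by apply: eq_esum => q <-.
have nup : (0 < nu (g b) (fstD p))%R by rewrite -fstD_sndD.
have eqS (r : D) : sndD r = b ->
    (nu (g b) (fstD r))%:E * S r =
    (nu (g b) (fstD r) * psi (fstD r) (sndD r))%:E.
  move: r; apply: esum_eq_terms => [r _| |].
  - apply/andP; split.
      by rewrite mule_ge0 ?lee_fin// esum_ge0// => q _; rewrite lee_fin.
    by rewrite EFinM lee_wpmul2l ?lee_fin//; exact: excessive.
  - by rewrite psi_mean_sndD ltry.
  - by rewrite psi_mean_sndD nuS.
have := eqS p erefl.
move=> /(congr1 (fun x => (nu (g b) (fstD p))^-1%:E * x)).
by rewrite EFinM !muleA -!EFinM mulVf ?gt_eqF// mul1e mul1r.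
Qed.

Local Notation D' := (@Delta' R A B C f g PX PY PZ).
Local Notation proj := (@proj_snd R A B C f g PX PY PZ).

Lemma phi_gt0 (p : D') : (0 < psi (fstD (val p)) (sndD (val p)))%R.
Proof. by rewrite -lte_fin -phiE; exact: valP p. Qed.

Lemma esum_Delta' (J : set D) (k : D -> \bar R) :
  (forall q, psi (fstD q) (sndD q) = 0%R -> k q = 0) ->
  \esum_(p in (val : D' -> D) @^-1` J) k (val p) = \esum_(q in J) k q.
Proof.
move=> k0; pose I := J `&` [set q | 0 < @phi R A B C f g PX PY PZ q].
rewrite -(@esum_support _ _ I J); last 2 first.
- by move=> q [].
- move=> q Jq /not_andP[//|/negP]; rewrite phiE lte_fin -leNgt => psi_le0.
  by apply: k0; apply/eqP; rewrite eq_le psi_le0 psi_ge0// fstD_sndD.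
rewrite (reindex_esum ((val : D' -> D) @^-1` J) I (val : D' -> D))//; split.
- by move=> p Jp; split => //; exact: valP p.
- by move=> p q _ _; exact: val_inj.
- by move=> q [Jq phi_q]; exists (exist _ q phi_q).
Qed.

(** The law [nu (g b)] of the first coordinate, reweighted by [phi]: it will be
    the conditional law of the coupling when its second coordinate is [b]. *)
Definition coupling_kernel (b : B) (p : D') : R :=
  if proj p == b
  then (nu (g b) (fstD (val p)) * psi (fstD (val p)) (sndD (val p)))%R else 0%R.

Let kernel_ge0 b p : (0 <= coupling_kernel b p)%R.
Proof.
by rewrite /coupling_kernel; case: ifP.
Qed.

Lemma coupling_kernel_fiber b :
  \esum_(p in proj @^-1` [set b]) (coupling_kernel b p)%:E = 1.
Proof.
rewrite -(psi_mean_sndD b).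
rewrite -(@esum_Delta' _
  (fun q => (nu (g b) (fstD q) * psi (fstD q) (sndD q))%:E)); last first.
  by move=> q ->; rewrite mulr0.
by apply: eq_esum => p pb; rewrite /coupling_kernel ifT//; apply/eqP.
Qed.

Lemma coupling_kernel_distribution b :
  is_distribution (coupling_kernel b) /\
  forall p, proj p <> b -> coupling_kernel b p = 0%R.
Proof.
have supp p : proj p <> b -> coupling_kernel b p = 0%R.
  by move=> pb; rewrite /coupling_kernel ifF//; apply/eqP.
split => //; split => [//|].
rewrite -(coupling_kernel_fiber b); apply/esym/esum_support => // p _ pb.
by rewrite supp.
Qed.

Lemma coupling_P_stochastic :
  is_stochastic (@coupling_P R A B C f g PX PY PZ).
Proof.
move=> p; have psip := phi_gt0 p.
have fphi q : fine (@phi R A B C f g PX PY PZ q) = psi (fstD q) (sndD q).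
  by rewrite phiE.
split => [q|].
  rewrite /coupling_P !fphi !mulr_ge0 ?invr_ge0 ?Rmat_ge0//; apply: ltW => //.
  exact: phi_gt0.
pose k (q : D) := ((psi (fstD (val p)) (sndD (val p)))^-1%:E *
  (M (val p) q * psi (fstD q) (sndD q))%:E).
transitivity (\esum_(q in (val : D' -> D) @^-1` setT) k (val q)).
  by apply: eq_esum => q _; rewrite /coupling_P !fphi /k -EFinM mulrA.
rewrite esum_Delta' /k; last by move=> q ->; rewrite mulr0 mule0.
rewrite esumZ; last 2 first.
- by rewrite invr_ge0 ltW.
- by move=> q; rewrite lee_fin mulr_ge0 ?Rmat_ge0// psi_ge0// fstD_sndD.
by rewrite psi_harmonic -EFinM mulVf// gt_eqF.
Qed.

Lemma coupling_kernel_intertwines b b' (q : D') : proj q = b' ->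
  \esum_(p in proj @^-1` [set b])
    (coupling_kernel b p * coupling_P p q)%:E =
  (PY b b' * coupling_kernel b' q)%:E.
Proof.
move=> qb'.
have psiq0 : (0 <= psi (fstD (val q)) (sndD (val q)))%R.
  by rewrite ltW// phi_gt0.
pose k (p : D) := ((psi (fstD (val q)) (sndD (val q)))%:E *
  (nu (g b) (fstD p) * M p (val q))%:E).
transitivity (\esum_(p in (val : D' -> D) @^-1`
    (@sndD _ _ _ f g @^-1` [set b])) k (val p)).
  apply: eq_esum => p pb; rewrite /coupling_kernel ifT; last exact/eqP.
  rewrite /coupling_P !phiE /k -EFinM; congr EFin => /=.
  by field; rewrite gt_eqF// phi_gt0.
(* By harmonicity [R] does not lead from a zero of [phi] to [q], so the sum over
   [Delta'] may be extended to [Delta]. *)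
have killed (p : D) : psi (fstD p) (sndD p) = 0%R ->
    (M p (val q) * psi (fstD (val q)) (sndD (val q)))%R = 0%R.
  move=> psip; apply/eqP; rewrite eq_le mulr_ge0 ?Rmat_ge0// andbT.
  rewrite -lee_fin -psip -psi_harmonic.
  apply: (@esum_ge_term _ _ _
    (fun r => (M p r * psi (fstD r) (sndD r))%:E)) => //.
  by rewrite lee_fin mulr_ge0 ?Rmat_ge0.
rewrite esum_Delta' /k; last first.
  move=> p /killed Mq; rewrite -EFinM; congr EFin.
  by rewrite mulrC -mulrA Mq mulr0.
rewrite esumZ//; last by move=> p; rewrite lee_fin mulr_ge0 ?Rmat_ge0.
rewrite nu_Rmat -EFinM /coupling_kernel qb' eqxx -qb' /proj_snd; congr EFin.
by ring.
Qed.

Variables (aX : A -> R) (aY : B -> R) (aZ : C -> R).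
Hypotheses (aX_nu : forall a, aX a = (aZ (f a) * nu (f a) a)%R)
  (aY_dist : is_distribution aY) (aZ_ge0 : forall c, (0 <= aZ c)%R)
  (aY_eq0 : forall b, aZ (g b) = 0%R -> aY b = 0%R).

Let aY0 b : (0 <= aY b)%R. Proof. by case: aY_dist. Qed.

Lemma coupling_alphaE (p : D') :
  coupling_alpha aX aY aZ p = (aY (proj p) * coupling_kernel (proj p) p)%R.
Proof.
rewrite /coupling_alpha /coupling_kernel eqxx phiE aX_nu fstD_sndD /=.
have := aZ_ge0 (g (sndD (val p))); rewrite le_eqVlt => /predU1P[aZ_eq0|aZ_gt0].
  by rewrite -aZ_eq0 ltxx /proj_snd aY_eq0 ?mul0r.
by rewrite aZ_gt0 /proj_snd; field; rewrite gt_eqF.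
Qed.

Lemma coupling_alpha_fiber b :
  \esum_(p in proj @^-1` [set b]) (coupling_alpha aX aY aZ p)%:E = (aY b)%:E.
Proof.
rewrite -[RHS]mule1 -(coupling_kernel_fiber b) -esumZ//; last first.
  by move=> p; rewrite lee_fin.
by apply: eq_esum => p <-; rewrite coupling_alphaE.
Qed.

Lemma coupling_exact_lumping : exact_lumping proj
  (coupling_alpha aX aY aZ) (coupling_P (PX := PX) (PY := PY) (PZ := PZ)) aY PY.
Proof.
split.
- move=> b; apply: contrapT => none.
  have := coupling_kernel_fiber b; rewrite esum1.
    by move=> /esym/eqP; rewrite onee_eq0.
  by move=> p pb; case: none; exists p.
- split; last exact: coupling_P_stochastic.
  have alpha0 (p : D') : (0 <= coupling_alpha aX aY aZ p)%R.
    by rewrite coupling_alphaE mulr_ge0.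
  split => //; rewrite -(esum_fibersT proj); last by move=> p; rewrite lee_fin.
  have [_ <-] := aY_dist; apply: eq_esum => b _; exact: coupling_alpha_fiber.
- by split => //; exact: coupling_alpha_fiber.
- exists coupling_kernel; split.
  + exact: coupling_kernel_distribution.
  + exact: coupling_kernel_intertwines.
  + exists aY => // p; rewrite coupling_alphaE.
    rewrite -(@esum_support _ _ [set proj p] setT)//.
      by rewrite esum_set1// lee_fin mulr_ge0.
    move=> b _ /= pb; have [_ ->] := coupling_kernel_distribution b.
      by rewrite mulr0.
    by move=> pb'; apply: pb.
Qed.

End Coupling.

(** * Exact lumpings charge the visited states *)

Section ExactLumpingKernel.
Context {R : realType} {A C : countType}.
Variables (f : A -> C) (aX : A -> R) (PX : A -> A -> R) (aZ : C -> R)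
  (PZ : C -> C -> R) (nu : C -> A -> R).
Hypotheses (PX_stoch : is_stochastic PX)
  (nu_dist : forall c, is_distribution (nu c) /\
    forall a, f a <> c -> nu c a = 0%R)
  (nu_PX : forall c c' a', f a' = c' ->
    \esum_(a in f @^-1` [set c]) (nu c a * PX a a')%:E =
    (PZ c c' * nu c' a')%:E).

(** The convex weights are determined by the pushforward of [aX], since the
    kernels live on disjoint fibres. *)
Lemma mixture_weights (w : C -> R) :
  is_distribution w -> is_pushforward f aX aZ ->
  (forall a, (aX a)%:E = \esum_(c in [set: C]) (w c * nu c a)%:E) ->
  forall a, aX a = (aZ (f a) * nu (f a) a)%R.
Proof.
move=> [w0 _] aXZ aXw.
have nu0 c a : (0 <= nu c a)%R by case: (nu_dist c) => -[].
have aX_w a : aX a = (w (f a) * nu (f a) a)%R.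
  apply: EFin_inj; rewrite aXw -(@esum_support _ _ [set f a] setT)//.
    by rewrite esum_set1// lee_fin mulr_ge0.
  move=> c _ /= ca; have [_ ->] := nu_dist c; first by rewrite mulr0.
  by move=> ac; apply: ca.
move=> a; rewrite aX_w; congr (_ * _)%R; apply: EFin_inj.
rewrite -(aXZ (f a)).
transitivity (\esum_(a' in f @^-1` [set f a])
    ((w (f a))%:E * (nu (f a) a')%:E)).
  rewrite esumZ//; last by move=> a'; rewrite lee_fin.
  by rewrite (nu_fiber nu_dist) mule1.
by apply: eq_esum => a' fa'; rewrite aX_w fa'.
Qed.

(** The relation between [nu] and [PX] propagates positivity of [nu] along the
    transitions of the chain. *)
Lemma visited_nu_gt0 d (O : measurableType d) (Pr : probability O R)
    (X : nat -> O -> A) (a : A) :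
  markov_chain Pr X aX PX -> (forall a, aX a = (aZ (f a) * nu (f a) a)%R) ->
  ~ never_visited Pr X a -> (0 < nu (f a) a)%R.
Proof.
move=> hX aX_nu /(visited_past hX)[t [x [<- {a}]]].
have [_ mX init step] := hX.
have nu0 c a : (0 <= nu c a)%R by case: (nu_dist c) => -[].
have neq0 a : nu (f a) a <> 0%R -> (0 < nu (f a) a)%R.
  by move=> /eqP nua; rewrite lt_neqAle eq_sym nua nu0.
elim: t => [|t IH] pos; apply: neq0 => nu_eq0.
  move: pos; rewrite (_ : [set w | _] = X 0%N @^-1` [set x 0%N]).
    by rewrite init aX_nu nu_eq0 mulr0 ltxx.
  apply/seteqP; split => w /=; first by apply.
  by move=> wx s; rewrite leqn0 => /eqP ->.
move: pos; rewrite [X in 0 < X](step t x) => pos.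
have PX_neq0 : PX (x t) (x t.+1) != 0%R.
  by apply: contraTneq pos => ->; rewrite mule0 ltxx.
have past_gt0 : 0 < Pr [set w | path_past t x (X ^~ w)].
  rewrite lt_neqAle measure_ge0 andbT eq_sym; apply: contraTneq pos => pos0.
  by rewrite [X in X * _]pos0 mul0e ltxx.
have := nu_PX (f (x t)) (erefl (f (x t.+1))); rewrite nu_eq0 mulr0 => sum0.
have : (nu (f (x t)) (x t) * PX (x t) (x t.+1))%:E <= 0.
  rewrite -[leRHS]sum0; apply: (@esum_ge_term _ _ _
    (fun a => (nu (f (x t)) a * PX a (x t.+1))%:E)) => //.
  by rewrite lee_fin mulr_ge0//; case: (PX_stoch (x t)).
have PX_gt0 : (0 < PX (x t) (x t.+1))%R.
  by rewrite lt_neqAle eq_sym PX_neq0 /=; case: (PX_stoch (x t)).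
by rewrite lee_fin leNgt mulr_gt0// IH.
Qed.

End ExactLumpingKernel.

Theorem proposition10 (R : realType) (A B C : countType)
  (dX dY dZ : measure_display)
  (OX : measurableType dX) (OY : measurableType dY) (OZ : measurableType dZ)
  (PrX : probability OX R) (PrY : probability OY R) (PrZ : probability OZ R)
  (X : nat -> OX -> A) (Y : nat -> OY -> B) (Z : nat -> OZ -> C)
  (aX : A -> R) (PX : A -> A -> R)
  (aY : B -> R) (PY : B -> B -> R)
  (aZ : C -> R) (PZ : C -> C -> R)
  (f : A -> C) (g : B -> C)
  (hX : markov_chain PrX X aX PX)
  (hY : markov_chain PrY Y aY PY)
  (hZ : markov_chain PrZ Z aZ PZ)
  (hfX : equal_in_law PrX (fun t w => f (X t w)) PrZ Z)
  (hgY : equal_in_law PrZ Z PrY (fun t w => g (Y t w)))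
  (hf : exact_lumping f aX PX aZ PZ)
  (hB : forall b, ~ never_visited PrY Y b)
  (hA : forall a, ~ never_visited PrX X a) :
  exact_lumping (@proj_snd R A B C f g PX PY PZ)
    (coupling_alpha aX aY aZ) (coupling_P (PX := PX) (PY := PY) (PZ := PZ)) aY PY.
Proof.
have [[_ PX_stoch] _ _ _] := hX.
have [[aY_dist PY_stoch] mY aY_init _] := hY.
have [[[aZ_ge0 _] PZ_stoch] _ aZ_init _] := hZ.
have [_ _ [aXZ _] [nu [nu_dist nu_PX [w w_dist aX_w]]]] := hf.
have aX_nu := mixture_weights nu_dist w_dist aXZ aX_w.
have nu_gt0 a := visited_nu_gt0 PX_stoch nu_dist nu_PX hX aX_nu (hA a).
apply: (@coupling_exact_lumping _ _ _ _ f g PX PY PZ PX_stoch PY_stoch PZ_stoch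
  nu nu_dist nu_gt0 nu_PX) => // b.
  exact: observed_dominated hY hZ hgY (hB b).
move=> aZ_eq0; apply/eqP; rewrite eq_le (proj1 aY_dist) andbT -lee_fin.
rewrite -aY_init -aZ_eq0 -aZ_init.
have -> : Z 0%N @^-1` [set g b] =
  [set w | [set z : nat -> C | [set g b] (z 0%N)] (Z ^~ w)] by [].
rewrite hgY; last exact: path_measurable_at.
apply: le_measure; rewrite ?inE; first exact: mY.
  exact: (mY 0%N (g @^-1` [set g b])).
by move=> o /= ->.
Qed.
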